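(* Let $Q$ be a finitely generated residually finite quandle. Then the endomorphism monoid $\mathrm{End}(Q)$ is a residually finite monoid and the automorphism group $\mathrm{Aut}(Q)$ is a residually finite group.
   Context: A quandle is a non-empty set $Q$ with a binary operation $*$ such that (Q1) $x*x=x$ for all $x\in Q$; (Q2) for all $x,y\in Q$ there is a unique $z\in Q$ with $x=z*y$ (write $z=x*^{-1}y$); (Q3) $(x*y)*z=(x*z)*(y*z)$ for all $x,y,z\in Q$. A homomorphism of quandles is a map preserving $*$; $\mathrm{End}(Q)$ is the monoid (under composition) of all quandle endomorphisms of $Q$, and $\mathrm{Aut}(Q)$ is the group of all quandle automorphisms. $Q$ is finitely generated if there is a finite subset of $Q$ not contained in any proper subquandle (a subquandle being a non-empty subset closed under $*$ and $*^{-1}$). $Q$ is residually finite if for any distinct $a,b\in Q$ there exist a finite quandle $F$ and a homomorphism $f:Q\to F$ with $f(a)\neq f(b)$. A monoid (group) $M$ is residually finite if any two distinct elements are separated by a homomorphism from $M$ to a finite monoid (group). *)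

(* Defs.v *)
From HB Require Import structures.
From mathcomp Require Import all_boot all_fingroup.
From mathcomp Require Import boolp classical_sets functions cardinality.

Set Implicit Arguments.
Unset Strict Implicit.
Unset Printing Implicit Defensive.

Local Open Scope classical_set_scope.

Declare Scope quandle_scope.
Delimit Scope quandle_scope with quandle.
Local Open Scope quandle_scope.

HB.mixin Record isQuandle (Q : Type) := {
  qop : Q -> Q -> Q;
  quandle_inhabited : inhabited Q;
  qop_idem : forall x, qop x x = x;
  qop_uniq : forall x y, exists! z, x = qop z y;
  qop_distr : forall x y z, qop (qop x y) z = qop (qop x z) (qop y z)
}.

#[short(type="quandleType")]
HB.structure Definition Quandle := {Q of isQuandle Q}.

Notation "x *q y" := (qop x y)
  (at level 40, left associativity) : quandle_scope.

Definition qinv (Q : quandleType) (x y : Q) : Q := sval (cid (qop_uniq x y)).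

Notation "x /q y" := (qinv x y)
  (at level 40, left associativity) : quandle_scope.

Section QuandleTheory.
Variable Q : quandleType.
Implicit Types x y z : Q.

Lemma qinvK x y : (x /q y) *q y = x.
Proof. by rewrite /qinv; case: cid => z [] /= xE _; rewrite -xE. Qed.

Lemma qopI y : injective (fun x => x *q y).
Proof.
move=> x z /= xz; have [w [_ wU]] := qop_uniq (x *q y) y.
by rewrite -(wU x) // -(wU z).
Qed.

Lemma qopK x y : (x *q y) /q y = x.
Proof. by apply: (@qopI y); rewrite qinvK. Qed.

End QuandleTheory.

Definition subquandle (Q : quandleType) (S : set Q) : Prop :=
  [/\ S !=set0,
      forall x y, S x -> S y -> S (x *q y)
    & forall x y, S x -> S y -> S (x /q y)].

Definition fg_quandle (Q : quandleType) : Prop :=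
  exists A : set Q, finite_set A /\
    ~ exists S : set Q, [/\ subquandle S, S `<` [set: Q] & A `<=` S].

Record quandle_hom (Q R : quandleType) := QuandleHom {
  qhom_fun :> Q -> R;
  qhomM : {morph qhom_fun : x y / x *q y}
}.

Lemma qhomP (Q R : quandleType) (f g : quandle_hom Q R) : f =1 g -> f = g.
Proof.
case: f g => [f fM] [g gM] /= /funext fg; case: _ / fg gM => gM.
by congr QuandleHom; exact: Prop_irrelevance.
Qed.

Definition residually_finite_quandle (Q : quandleType) : Prop :=
  forall a b : Q, a <> b ->
    exists (F : quandleType) (f : quandle_hom Q F),
      finite_set [set: F] /\ f a <> f b.

Definition residually_finite_monoid (M : monoidType) : Prop :=
  forall a b : M, a <> b ->
    exists (F : monoidType) (f : UMagmaMorphism.type M F),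
      finite_set [set: F] /\ f a <> f b.

Definition residually_finite_group (G : groupType) : Prop :=
  forall a b : G, a <> b ->
    exists (F : finGroupType) (f : UMagmaMorphism.type G F),
      f a <> f b.

Definition quandle_id (Q : quandleType) : quandle_hom Q Q :=
  @QuandleHom Q Q idfun (fun _ _ => erefl).

Lemma comp_qhomM (Q R S : quandleType)
    (g : quandle_hom R S) (f : quandle_hom Q R) :
  {morph g \o f : x y / x *q y}.
Proof. by move=> x y /=; rewrite !qhomM. Qed.

Definition quandle_comp (Q R S : quandleType)
    (g : quandle_hom R S) (f : quandle_hom Q R) : quandle_hom Q S :=
  QuandleHom (comp_qhomM g f).

Definition quandle_end (Q : quandleType) : Type := quandle_hom Q Q.

Section EndMonoid.
Variable Q : quandleType.
Implicit Types f g h : quandle_end Q.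

(* Monoids carry a choice structure in this library; boolp provides one for
   an arbitrary type. *)
HB.instance Definition _ := gen_eqMixin (quandle_end Q).
HB.instance Definition _ := gen_choiceMixin (quandle_end Q).

Definition end_mul f g : quandle_end Q := quandle_comp f g.
Definition end_one : quandle_end Q := quandle_id Q.

Fact end_mulA : associative end_mul.
Proof. by move=> f g h; apply: qhomP. Qed.

Fact end_mul1 : left_id end_one end_mul.
Proof. by move=> f; apply: qhomP. Qed.

Fact end_mulr1 : right_id end_one end_mul.
Proof. by move=> f; apply: qhomP. Qed.

HB.instance Definition _ :=
  isMonoid.Build (quandle_end Q) end_mulA end_mul1 end_mulr1.

End EndMonoid.

Record quandle_aut (Q : quandleType) := QuandleAut {
  aut_hom :> quandle_hom Q Q;
  aut_bij : bijective aut_hom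
}.

Section AutGroup.
Variable Q : quandleType.
Implicit Types f g h : quandle_aut Q.

Lemma qautP f g : f =1 g -> f = g.
Proof.
case: f g => [f fb] [g gb] /= /qhomP fg; case: _ / fg gb => gb.
by congr QuandleAut; exact: Prop_irrelevance.
Qed.

HB.instance Definition _ := gen_eqMixin (quandle_aut Q).
HB.instance Definition _ := gen_choiceMixin (quandle_aut Q).

Definition aut_mul f g : quandle_aut Q :=
  @QuandleAut Q (quandle_comp f g) (bij_comp (aut_bij f) (aut_bij g)).

Definition aut_one : quandle_aut Q :=
  @QuandleAut Q (quandle_id Q) (Bijective (frefl _) (frefl _)).

Lemma aut_inv_ex f : exists g : Q -> Q, cancel f g /\ cancel g f.
Proof. by have [g fK gK] := aut_bij f; exists g. Qed.

Definition aut_inv_fun f : Q -> Q := sval (cid (aut_inv_ex f)).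

Lemma aut_inv_funK f : cancel f (aut_inv_fun f).
Proof. by rewrite /aut_inv_fun; case: cid => g [] /=. Qed.

Lemma aut_inv_funVK f : cancel (aut_inv_fun f) f.
Proof. by rewrite /aut_inv_fun; case: cid => g [] /=. Qed.

Lemma aut_inv_funM f : {morph aut_inv_fun f : x y / x *q y}.
Proof.
move=> x y; apply: (can_inj (aut_inv_funK f)).
by rewrite qhomM !aut_inv_funVK.
Qed.

Definition aut_inv f : quandle_aut Q :=
  @QuandleAut Q (QuandleHom (aut_inv_funM f))
    (Bijective (aut_inv_funVK f) (aut_inv_funK f)).

Fact aut_mulA : associative aut_mul.
Proof. by move=> f g h; apply: qautP. Qed.

Fact aut_mul1 : left_id aut_one aut_mul.
Proof. by move=> f; apply: qautP. Qed.

Fact aut_mulr1 : right_id aut_one aut_mul.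
Proof. by move=> f; apply: qautP. Qed.

Fact aut_mulV : left_inverse aut_one aut_inv aut_mul.
Proof. by move=> f; apply: qautP; exact: aut_inv_funK. Qed.

Fact aut_mulrV : right_inverse aut_one aut_inv aut_mul.
Proof. by move=> f; apply: qautP; exact: aut_inv_funVK. Qed.

HB.instance Definition _ :=
  isGroup.Build (quandle_aut Q) aut_mulA aut_mul1 aut_mulr1 aut_mulV aut_mulrV.

End AutGroup.

(* Main.v *)
Require Import Defs.
From HB Require Import structures.
From mathcomp Require Import all_boot all_fingroup.
From mathcomp Require Import boolp classical_sets functions cardinality.

(** Let Q be finitely generated.  A homomorphism out of Q is determined by its
values on a finite generating set, because the points where two
homomorphisms agree form, if there are any, a subquandle; hence Hom(Q, F) is finite for every finite quandle F
([finite_quandle_hom]).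

Precomposition lets End(Q) act on the right of this finite set: p . f = p o f.
A right action of a monoid on a finite set X is a homomorphism to the finite
monoid of self-maps of X, composed from left to right, and a right action of a
group is a homomorphism to the finite symmetric group of X; so two elements
that act differently on some point are separated by a finite quotient
([monoid_act_separates], [group_act_separates]).

Residual finiteness of Q supplies such a point.  If f <> g, choose x with
f x <> g x and p : Q -> F, F finite, that separates f x from g x: then p o f
and p o g are different points of Hom(Q, F) ([precomp_separates]).  The same
argument serves Aut(Q), acting through its inclusion in End(Q). *)

Set Implicit Arguments.
Unset Strict Implicit.
Unset Printing Implicit Defensive.
Local Open Scope classical_set_scope.
Local Open Scope group_scope.
Local Open Scope quandle_scope.

(** Turns the propositional finiteness of a bare type into a finType with the
same carrier, over which finite functions and permutations can be formed.
A list of all the elements embeds T in a sequence subtype, whose finType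
structure is pulled back along that embedding. *)
Lemma finite_setT_finType (T : Type) :
  finite_set [set: T] -> exists F : finType, F = T :> Type.
Proof.
move=> /(@finite_seqP {classic T})[s /seteqP[sT _]].
have mem_s (x : {classic T}) : x \in s by exact: sT.
pose toF (x : {classic T}) : seq_sub s := SeqSub (mem_s x).
have toFK : cancel toF (@ssval _ s) by [].
by exists (can_type toFK : finType).
Qed.

Lemma finite_setT_inj (T : Type) (F : finType) (f : T -> F) :
  injective f -> finite_set [set: T].
Proof.
move=> fI; rewrite -(preimage_setT f); apply: finite_preimage => //.
by move=> x y _ _; exact: fI.
Qed.

(** A copy of the finite functions on X, kept distinct from them so that the
monoid structure below is tied to composition only. *)
Definition right_transf (X : finType) : Type := {ffun X -> X}.

Section RightTransformations.
Variable X : finType.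
Implicit Types s t u : right_transf X.

HB.instance Definition _ := Finite.on (right_transf X).

(** Composition runs from left to right, as for permutations: with this order
a right action is a homomorphism, not an anti-homomorphism. *)
Definition rt_mul s t : right_transf X := [ffun x => t (s x)].
Definition rt_one : right_transf X := [ffun x => x].

Fact rt_mulA : associative rt_mul.
Proof. by move=> s t u; apply/ffunP => x; rewrite !ffunE. Qed.

Fact rt_mul1 : left_id rt_one rt_mul.
Proof. by move=> s; apply/ffunP => x; rewrite !ffunE. Qed.

Fact rt_mulr1 : right_id rt_one rt_mul.
Proof. by move=> s; apply/ffunP => x; rewrite !ffunE. Qed.

HB.instance Definition _ :=
  isMonoid.Build (right_transf X) rt_mulA rt_mul1 rt_mulr1.

End RightTransformations.

Lemma monoid_act_separates (M : monoidType) (X : Type) (act : X -> M -> X)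
    (act1 : forall x, act x 1 = x)
    (actM : forall x a b, act x (a * b) = act (act x a) b)
    (a b : M) (x : X) :
  finite_set [set: X] -> act x a <> act x b ->
  exists (F : monoidType) (f : UMagmaMorphism.type M F),
    finite_set [set: F] /\ f a <> f b.
Proof.
move=> /finite_setT_finType[F EF]; case: X / EF in act act1 actM x * => xab.
pose f c : right_transf F := [ffun y => act y c].
have f1 : f 1 = 1 by apply/ffunP => y; rewrite !ffunE.
have fM : {morph f : c d / c * d}.
  by move=> c d; apply/ffunP => y; rewrite !ffunE.
pose fm := isUMagmaMorphism.Build M (right_transf F) f (conj f1 fM).
exists (right_transf F),
  (HB.pack_for (UMagmaMorphism.type M (right_transf F)) f fm).
split; first exact: finite_finset.
by move=> /= /ffunP/(_ x); rewrite !ffunE.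
Qed.

(** The inverse of an element acts as the inverse map, so a group acts by
permutations. *)
Lemma group_act_separates (G : groupType) (X : Type) (act : X -> G -> X)
    (act1 : forall x, act x 1 = x)
    (actM : forall x a b, act x (a * b) = act (act x a) b)
    (a b : G) (x : X) :
  finite_set [set: X] -> act x a <> act x b ->
  exists (F : finGroupType) (f : UMagmaMorphism.type G F), f a <> f b.
Proof.
move=> /finite_setT_finType[F EF]; case: X / EF in act act1 actM x * => xab.
have act_inj c : injective (act^~ c).
  by apply: (can_inj (g := act^~ c^-1)) => y; rewrite -actM mulgV act1.
pose f c : {perm F} := perm (act_inj c).
have f1 : f 1 = 1 by apply/permP => y; rewrite permE perm1.
have fM : {morph f : c d / c * d}.
  by move=> c d; apply/permP => y; rewrite permM !permE.
pose fm := isUMagmaMorphism.Build G {perm F} f (conj f1 fM).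
exists {perm F}, (HB.pack_for (UMagmaMorphism.type G {perm F}) f fm).
by move=> /= /permP/(_ x); rewrite !permE.
Qed.

Lemma qhom_inv (Q R : quandleType) (f : quandle_hom Q R) :
  {morph f : x y / x /q y}.
Proof. by move=> x y; apply: (@qopI _ (f y)); rewrite -qhomM !qinvK. Qed.

Lemma subquandle_equalizer (Q R : quandleType) (f g : quandle_hom Q R) (x : Q) :
  f x = g x -> subquandle [set y | f y = g y].
Proof.
move=> fgx; split; first by exists x.
- by move=> y z /= fgy fgz; rewrite !qhomM fgy fgz.
- by move=> y z /= fgy fgz; rewrite !qhom_inv fgy fgz.
Qed.

(** The equalizer of f and g is a subquandle; if it contains generators of Q, it
is all of Q. *)
Lemma fg_quandle_hom_ext (Q : quandleType) :
  fg_quandle Q ->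
  exists s : seq {classic Q}, forall (R : quandleType) (f g : quandle_hom Q R),
    {in s, f =1 g} -> f = g.
Proof.
case=> A [/(@finite_seqP {classic Q})[s ->] gen_s].
have [x] := quandle_inhabited (s := Q).
(* The generating set may be empty, when Q is a point; adjoining some x ensures
   that the equalizer is non-empty, as a subquandle must be. *)
exists (x :: s) => R f g fg; apply: qhomP => y; apply: contrapT => fgy.
apply: gen_s; exists [set z | f z = g z]; split.
- by apply: (@subquandle_equalizer _ _ _ _ x); exact/fg/mem_head.
- by split => // fgT; exact/fgy/fgT.
- by move=> z /= zs; apply: fg; rewrite in_cons zs orbT.
Qed.

(** Evaluation on a finite list of generators embeds Hom(Q, R) in a finite power
of R. *)
Lemma finite_quandle_hom (Q R : quandleType) :
  fg_quandle Q -> finite_set [set: R] -> finite_set [set: quandle_hom Q R].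
Proof.
move=> /fg_quandle_hom_ext[s ext_s] /finite_setT_finType[F FR].
have [toF toFI] : exists toF : R -> F, injective toF.
  by case: _ / FR; exists id.
pose values (f : quandle_hom Q R) := map_tuple (toF \o f) (in_tuple s).
apply: (@finite_setT_inj _ _ values) => f g fg.
apply: ext_s => z zs; apply: toFI.
by have /(@eq_in_map {classic Q}) := congr1 val fg; exact.
Qed.

(** Residual finiteness of Q says that homomorphisms to finite quandles detect
where f and g differ at a point, hence distinguish f from g. *)
Lemma precomp_separates (Q : quandleType) (f g : quandle_hom Q Q) :
  residually_finite_quandle Q -> f <> g ->
  exists (F : quandleType) (p : quandle_hom Q F),
    finite_set [set: F] /\ quandle_comp p f <> quandle_comp p g.
Proof.
move=> Qrf fg; have [x fgx] : exists x, f x <> g x.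
  by apply/existsNP => /qhomP.
have [F [p [Ffin pfg]]] := Qrf _ _ fgx; exists F, p; split=> // pfpg.
by apply: pfg; have /(congr1 (fun h : quandle_hom Q F => h x)) := pfpg.
Qed.

Theorem corollary2p4 (Q : quandleType)
  (Qfg : fg_quandle Q) (Qrf : residually_finite_quandle Q) :
  residually_finite_monoid (quandle_end Q) /\
  residually_finite_group (quandle_aut Q).
Proof.
split=> f g fg.
- have [F [p [Ffin pfg]]] := precomp_separates Qrf fg.
  apply: (@monoid_act_separates (quandle_end Q) _ (@quandle_comp Q Q F) _ _ _ _ p) => //.
  + by move=> h; exact: qhomP.
  + by move=> h a b; exact: qhomP.
  + exact: finite_quandle_hom.
- have fg' : aut_hom f <> aut_hom g.
    by move=> fgE; apply: fg; apply: qautP => x; rewrite fgE.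
  have [F [p [Ffin pfg]]] := precomp_separates Qrf fg'.
  apply: (@group_act_separates (quandle_aut Q) _ (fun h a => quandle_comp h (aut_hom a))
    _ _ _ _ p) => //.
  + by move=> h; exact: qhomP.
  + by move=> h a b; exact: qhomP.
  + exact: finite_quandle_hom.
Qed.
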